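(* Let $n$ be a positive integer which is not a perfect square and consider a solution $(a,b)$ (in integers) of the Pell equation $x^2-ny^2=1$. Given three polynomials $P,Q,D\in\mathbb{Z}[X]$ with $\deg(P)=\deg(D)=2$, the following conditions are equivalent: (1) We have the identity $P^2-DQ^2=1$, with $P(0)=a$, $Q(0)=b$ and $D(0)=n$. (2) There exist two integers $m\neq 0$ and $\varepsilon\in\{\pm1\}$ such that, setting \[c=\gcd\left(b^3,\,(a+\varepsilon)b,\,2(a+\varepsilon)^2\right),\] we have $P=P_0(c^{-1}mX)$, $Q=Q_0(c^{-1}mX)$ and $D=D_0(c^{-1}mX)$, with \[P_0=b^4(a+\varepsilon)X^2+2b^2(a+\varepsilon)X+a,\] \[Q_0=b^3X+b,\] \[D_0=(a+\varepsilon)^2b^2X^2+2(a+\varepsilon)^2X+n.\]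
   Formalization: The solution (a,b) is assumed to have b≠0; for b=0 the claim fails: n=2, (a,b)=(1,0), P=X^2+1, Q=X, D=X^2+2 satisfy (1), but P_0 is then constant, so (2) cannot hold (and c=0 for ε=-1). *)

(* Defs.v *)
From HB Require Import structures.
From mathcomp Require Import all_boot all_order all_algebra.

Set Implicit Arguments.
Unset Strict Implicit.
Unset Printing Implicit Defensive.

Import Order.TTheory GRing.Theory Num.Theory.
Local Open Scope ring_scope.

Definition polyQ (p : {poly int}) : {poly rat} :=
  map_poly (intr : int -> rat) p.

(* Positive as soon as b != 0, since gcdz is nonnegative. *)
Definition pell_gcd (a b eps : int) : int :=
  gcdz (gcdz (b ^+ 3) ((a + eps) * b)) (2 * (a + eps) ^+ 2).

Definition pell_P0 (a b eps : int) : {poly int} :=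
  (b ^+ 4 * (a + eps)) *: 'X^2 + (2 * b ^+ 2 * (a + eps)) *: 'X + a%:P.

Definition pell_Q0 (b : int) : {poly int} := b ^+ 3 *: 'X + b%:P.

Definition pell_D0 (n a b eps : int) : {poly int} :=
  ((a + eps) ^+ 2 * b ^+ 2) *: 'X^2 + (2 * (a + eps) ^+ 2) *: 'X + n%:P.

(* Main.v *)
Require Import Defs.
From HB Require Import structures.
From mathcomp Require Import all_boot all_order all_algebra.
From mathcomp Require Import ring.

Set Implicit Arguments.
Unset Strict Implicit.
Unset Printing Implicit Defensive.

Import Order.TTheory GRing.Theory Num.Theory.
Local Open Scope ring_scope.

(** Comparing degrees in P^2 - 1 = D Q^2 shows that Q has degree 1, so it has a
    rational root r, nonzero because Q(0) = b is. At r the equation and its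
    derivative give P(r)^2 = 1 and P(r) P'(r) = 0: setting eps = - P(r), a sign,
    the quadratic P + eps has r as a double root. Hence, with
    y = 1 + (q / b) X = 1 - X / r, where q is the leading coefficient of Q,
      Q = b y  and  P = (a + eps) y^2 - eps   ([pell_square_form]).
    The polynomials P0(tX) and Q0(tX) have exactly this shape with
    y = 1 + b^2 t X, so t = q / b^3. The family satisfies the Pell identity
    ([pell_family_identity]), and D = (P^2 - 1) / Q^2 is determined by P and Q;
    thus D = D0(tX) as well ([pell_family_complete]).

    It remains to see that c t is an integer. The numbers b^3 t = q and
    2 (a + eps)^2 t, a coefficient of D, are integers. The leading coefficient
    of D is ((a + eps) b t)^2, and a rational number whose square is an integer
    is an integer, so (a + eps) b t is one too. By Bezout so is c t, since c is
    the gcd of the three multipliers ([pell_gcd_clears]). *)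

Lemma pell_size_cofactor (F : fieldType) (P Q D : {poly F}) :
  size P = 3%N -> size D = 3%N -> Q != 0 ->
  P ^+ 2 - D * Q ^+ 2 = 1 -> size Q = 2%N.
Proof.
move=> sP sD Q0 E.
have P0 : P != 0 by rewrite -size_poly_gt0 sP.
have D0 : D != 0 by rewrite -size_poly_gt0 sD.
have : size (D * Q ^+ 2) = 5%N.
  have -> : D * Q ^+ 2 = P ^+ 2 - 1 by rewrite -E; ring.
  have s5 : size (P ^+ 2) = 5%N by rewrite expr2 size_mul // sP.
  by rewrite size_polyDl // s5 size_polyN size_poly1.
rewrite expr2 !size_mul ?mulf_neq0 // sD.
have : (0 < size Q)%N by rewrite size_poly_gt0.
by case: (size Q) => [|[|[|k]]] // _; rewrite !addnS.
Qed.

Lemma quadratic_double_root (F : fieldType) (p : {poly F}) (x : F) :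
  (size p <= 3)%N -> p.[x] = 0 -> p^`().[x] = 0 ->
  p = p`_2 *: ('X - x%:P) ^+ 2.
Proof.
move=> sp px dpx.
have Ep : p = p`_2 *: 'X^2 + p`_1 *: 'X + (p`_0)%:P.
  apply/polyP=> -[|[|[|i]]]; rewrite !(coefE, coefX, coefC, coefXn) /=
    ?mulr0 ?mulr1 ?addr0 ?add0r //.
  by move/leq_sizeP: sp => ->.
move: px dpx; rewrite {1 2}Ep !derivE !hornerE /= => px dpx.
have E1 : p`_1 = - (2 * p`_2 * x).
  by apply/eqP; rewrite -subr_eq0 -[X in _ == X]dpx; apply/eqP; ring.
have E0 : p`_0 = p`_2 * x ^+ 2.
  by apply/eqP; rewrite -subr_eq0 -[X in _ == X]px E1; apply/eqP; ring.
rewrite {1}Ep E0 E1 -!mul_polyC; ring.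
Qed.

(** The root r of Q is also a critical point of P at which P = - eps, so P + eps
    is a multiple of the square of Q. *)
Lemma pell_square_form (F : numFieldType) (P Q D : {poly F}) :
  size P = 3%N -> size D = 3%N -> Q.[0] != 0 ->
  P ^+ 2 - D * Q ^+ 2 = 1 ->
  exists2 eps : F, eps = 1 \/ eps = -1 &
    let y := 1 + (Q`_1 / Q.[0]) *: 'X in
    [/\ Q`_1 != 0, Q = Q.[0] *: y &
        P = (P.[0] + eps) *: y ^+ 2 - eps%:P].
Proof.
move=> sP sD b0 E; set b := Q.[0] in b0 *.
have Q0 : Q != 0 by apply: contraNneq b0 => Q0; rewrite /b Q0 horner0.
have sQ := pell_size_cofactor sP sD Q0 E.
have q0 : Q`_1 != 0 by move: Q0; rewrite -lead_coef_eq0 lead_coefE sQ.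
set q := Q`_1 in q0 *.
have EQ : Q = q *: 'X + b%:P.
  apply/polyP=> -[|[|i]]; rewrite !(coefE, coefX, coefC) /=
    ?mulr0 ?mulr1 ?addr0 ?add0r //.
    by rewrite /b horner_coef0.
  by have /leq_sizeP -> : (size Q <= 2)%N by rewrite sQ.
pose r := - (b / q).
have Qr : Q.[r] = 0 by rewrite EQ !hornerE /r; field.
have Pr2 : P.[r] ^+ 2 = 1.
  move: (congr1 (horner^~ r) E); rewrite !hornerE /= Qr => <-; ring.
(* Differentiating kills the constant 1, and D Q^2 vanishes doubly at r. *)
have P'r : P^`().[r] = 0.
  have := congr1 (fun p : {poly F} => p^`().[r]) E.
  rewrite !derivE !hornerE /= Qr !(mul0r, mulr0, addr0, subr0) => H.
  have Pr0 : P.[r] != 0 by rewrite -sqrf_eq0 Pr2 oner_eq0.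
  have /eqP : 2 * P.[r] * P^`().[r] = 0 by rewrite -H; ring.
  by rewrite !mulf_eq0 pnatr_eq0 (negbTE Pr0) => /eqP.
exists (- P.[r]).
  move/eqP: Pr2; rewrite sqrf_eq1.
  by case/orP=> /eqP ->; [right | left]; rewrite ?opprK.
have sPC : (size (P - P.[r]%:P)%R <= 3)%N.
  rewrite (leq_trans (size_polyD _ _)) // sP size_polyN geq_max size_polyC.
  by case: eqP.
have := quadratic_double_root (x := r) sPC.
rewrite !derivE !hornerE /= subrr subr0 => /(_ erefl P'r).
rewrite coefB coefC subr0 /= => EP.
have EPr : P.[0] - P.[r] = P`_2 * r ^+ 2.
  by move/(congr1 (horner^~ 0)): EP; rewrite !hornerE /= => ->; ring.
have Xr : 'X - r%:P = - r *: (1 + (q / b) *: 'X).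
  rewrite scalerDr scalerA -!mul_polyC /r opprK mulf_div mulrC (mulrC b).
  by rewrite divff ?mulf_neq0 //; ring.
split => //.
- by rewrite EQ scalerDr scalerA mulrCA divff // mulr1 -!mul_polyC; ring.
apply/eqP; rewrite EPr rmorphN opprK -subr_eq EP Xr -!mul_polyC; apply/eqP; ring.
Qed.

(** With y = 1 + b^2 X one has P0 = (a + eps) y^2 - eps and Q0 = b y, while
    b^2 D0 = (a + eps)^2 (y^2 - 1) + n b^2. The left-hand side is therefore
    y^2 (a^2 - n b^2 - eps^2) + eps^2. *)
Lemma pell_family_identity (n a b eps : int) :
  eps = 1 \/ eps = -1 -> a ^+ 2 - n * b ^+ 2 = 1 ->
  pell_P0 a b eps ^+ 2 - pell_D0 n a b eps * pell_Q0 b ^+ 2 = 1.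
Proof.
move=> eps1 pell.
have eps2 : eps ^+ 2 = 1 by case: eps1 => ->.
transitivity ((1 + (b ^+ 2)%:P * 'X) ^+ 2 * (a ^+ 2 - n * b ^+ 2 - eps ^+ 2)%:P
              + (eps ^+ 2)%:P).
  by rewrite /pell_P0 /pell_D0 /pell_Q0 -!mul_polyC; ring.
by rewrite pell eps2 subrr mulr0 add0r.
Qed.

Lemma polyQ_inj : injective polyQ.
Proof. exact: map_inj_poly intr_inj _. Qed.

Lemma size_polyQ (p : {poly int}) : size (polyQ p) = size p.
Proof. exact: size_map_inj_poly intr_inj _ p. Qed.

Lemma polyQ_horner0 (p : {poly int}) : (polyQ p).[0] = p.[0]%:~R.
Proof. by rewrite !horner_coef0 coef_map. Qed.

Lemma polyQ_scaled_horner0 (p : {poly int}) (t : rat) :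
  (polyQ p \Po (t *: 'X)).[0] = p.[0]%:~R.
Proof. by rewrite horner_comp hornerZ hornerX mulr0 polyQ_horner0. Qed.

Lemma polyQ_sub_sq (P Q D : {poly int}) :
  polyQ (P ^+ 2 - D * Q ^+ 2) = polyQ P ^+ 2 - polyQ D * polyQ Q ^+ 2.
Proof. by rewrite /polyQ rmorphB rmorphXn rmorphM rmorphXn. Qed.

Lemma polyQ_scaled_sub_sq (P Q D : {poly int}) (t : rat) :
  P ^+ 2 - D * Q ^+ 2 = 1 ->
  (polyQ P \Po (t *: 'X)) ^+ 2
    - (polyQ D \Po (t *: 'X)) * (polyQ Q \Po (t *: 'X)) ^+ 2 = 1.
Proof.
move/(congr1 (fun p => polyQ p \Po (t *: 'X))) => /=.
by rewrite polyQ_sub_sq rmorphB rmorphXn rmorphM rmorphXn /polyQ !rmorph1.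
Qed.

Lemma pell_P0_scaled (a b eps : int) (t : rat) :
  polyQ (pell_P0 a b eps) \Po (t *: 'X) =
  (a + eps)%:~R *: (1 + (b%:~R ^+ 2 * t) *: 'X) ^+ 2 - (eps%:~R)%:P.
Proof.
rewrite /polyQ /pell_P0 !rmorphD /= !map_polyZ map_polyXn map_polyX map_polyC /=.
rewrite !comp_polyZ comp_Xn_poly comp_polyX comp_polyC -!mul_polyC; ring.
Qed.

Lemma pell_Q0_scaled (b : int) (t : rat) :
  polyQ (pell_Q0 b) \Po (t *: 'X) =
  b%:~R *: (1 + (b%:~R ^+ 2 * t) *: 'X).
Proof.
rewrite /polyQ /pell_Q0 !rmorphD /= !map_polyZ map_polyX map_polyC /=.
rewrite !comp_polyZ comp_polyX comp_polyC -!mul_polyC; ring.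
Qed.

Lemma pell_D0_scaled (n a b eps : int) (t : rat) :
  polyQ (pell_D0 n a b eps) \Po (t *: 'X) =
  (((a + eps) * b)%:~R * t) ^+ 2 *: 'X^2 + ((2 * (a + eps) ^+ 2)%:~R * t) *: 'X
    + (n%:~R)%:P.
Proof.
rewrite /polyQ /pell_D0 !rmorphD /= !map_polyZ map_polyXn map_polyX map_polyC /=.
rewrite !comp_polyZ comp_Xn_poly comp_polyX comp_polyC -!mul_polyC; ring.
Qed.

Lemma dvdz_gcd_mul (d m n q : int) :
  (d %| m * q)%Z -> (d %| n * q)%Z -> (d %| gcdz m n * q)%Z.
Proof.
move=> dm dn; have [u [v <-]] := Bezoutz m n.
rewrite mulrDl -!mulrA; apply: rpredD; exact: dvdz_mull.
Qed.

(** Applied with q / b^3 the scaling factor: the two hypotheses say that the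
    leading and the linear coefficients of the scaled D0 are integers, the
    conclusion that the gcd clears the denominator of q / b^3. Taking the square
    root of the first one gives the divisibility for the factor (a + eps) b. *)
Lemma pell_gcd_clears (a b eps q : int) :
  (b ^+ 4 %| ((a + eps) * q) ^+ 2)%Z -> (b ^+ 3 %| 2 * (a + eps) ^+ 2 * q)%Z ->
  (b ^+ 3 %| pell_gcd a b eps * q)%Z.
Proof.
move=> d2 d1.
have d : (b ^+ 2 %| (a + eps) * q)%Z by rewrite -(@dvdz_pexp2r _ _ 2) // -exprM.
apply: dvdz_gcd_mul d1; apply: dvdz_gcd_mul; first exact: dvdz_mulr.
by rewrite mulrAC exprSr dvdz_mul.
Qed.

Lemma pell_gcd_neq0 (a b eps : int) : b != 0 -> pell_gcd a b eps != 0.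
Proof. by move=> b0; rewrite !gcdz_eq0 expf_eq0 (negbTE b0). Qed.

(** Integrality is left aside here: every solution is the family evaluated at
    t X for the rational number t = q / b^3, which Q0 = b^3 X + b dictates. *)
Lemma pell_family_complete (n a b : int) (P Q D : {poly int}) :
  a ^+ 2 - n * b ^+ 2 = 1 -> b != 0 -> size P = 3%N -> size D = 3%N ->
  P ^+ 2 - D * Q ^+ 2 = 1 -> P.[0] = a -> Q.[0] = b ->
  exists eps : int, [/\ eps = 1 \/ eps = -1, Q`_1 != 0 &
    let tX := ((Q`_1)%:~R / b%:~R ^+ 3) *: 'X in
    [/\ polyQ P = polyQ (pell_P0 a b eps) \Po tX,
        polyQ Q = polyQ (pell_Q0 b) \Po tX &
        polyQ D = polyQ (pell_D0 n a b eps) \Po tX]].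
Proof.
move=> pell b0 sP sD E Pa Qb.
have b0Q : b%:~R != 0 :> rat by rewrite intr_eq0.
have EQ : polyQ P ^+ 2 - polyQ D * polyQ Q ^+ 2 = 1.
  by rewrite -polyQ_sub_sq E /polyQ rmorph1.
have sPQ : size (polyQ P) = 3%N by rewrite size_polyQ.
have sDQ : size (polyQ D) = 3%N by rewrite size_polyQ.
have QQ0 : (polyQ Q).[0] != 0 by rewrite polyQ_horner0 Qb.
have [e e1] := pell_square_form sPQ sDQ QQ0 EQ.
have {e e1} [eps [eps1 ->]] :
    exists eps : int, (eps = 1 \/ eps = -1) /\ e = eps%:~R.
  by case: e1 => ->; [exists 1 | exists (-1)]; split; auto.
rewrite !polyQ_horner0 Pa Qb coef_map /= => -[q0 HQ HP].
exists eps; split=> //; first by rewrite intr_eq0 in q0.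
set t := _ / _ ^+ 3.
have tE : (Q`_1)%:~R / b%:~R = b%:~R ^+ 2 * t :> rat by rewrite /t; field.
have {}HP : polyQ P = polyQ (pell_P0 a b eps) \Po (t *: 'X).
  by rewrite pell_P0_scaled -tE HP rmorphD.
have {}HQ : polyQ Q = polyQ (pell_Q0 b) \Po (t *: 'X).
  by rewrite pell_Q0_scaled -tE HQ.
split=> //.
have Q2 : polyQ Q ^+ 2 != 0.
  rewrite expf_neq0 //; apply: contraNneq b0 => Q0.
  by rewrite -Qb -(inj_eq (@intr_inj rat)) -polyQ_horner0 Q0 horner0.
(* D and the scaled D0 are both (P^2 - 1) / Q^2. *)
apply: (mulIf Q2).
have := polyQ_scaled_sub_sq t (pell_family_identity eps1 pell).
by rewrite -HP -HQ -[in RHS]EQ => /addrI/oppr_inj.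
Qed.

Theorem proposition3 (n : int) (n_gt0 : 0 < n)
    (n_nonsquare : ~ exists k : int, n = k ^+ 2)
    (a b : int) (pell_ab : a ^+ 2 - n * b ^+ 2 = 1) (b_neq0 : b != 0)
    (P Q D : {poly int}) (degP : size P = 3%N) (degD : size D = 3%N) :
  [/\ P ^+ 2 - D * Q ^+ 2 = 1, P.[0] = a, Q.[0] = b & D.[0] = n]
  <->
  exists m eps : int,
    [/\ m != 0, eps = 1 \/ eps = -1 &
        let c : int := pell_gcd a b eps in
        let mX : {poly rat} := ((c%:~R)^-1 * m%:~R) *: 'X in
        [/\ polyQ P = polyQ (pell_P0 a b eps) \Po mX,
            polyQ Q = polyQ (pell_Q0 b) \Po mX &
            polyQ D = polyQ (pell_D0 n a b eps) \Po mX]].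
Proof.
split=> [[E Pa Qb Dn]|[m [eps [m0 eps1 /= [HP HQ HD]]]]]; last first.
  split.
  - apply: polyQ_inj; rewrite polyQ_sub_sq HP HQ HD /polyQ rmorph1.
    exact: polyQ_scaled_sub_sq (pell_family_identity eps1 pell_ab).
  - apply: (@intr_inj rat); rewrite -polyQ_horner0 HP polyQ_scaled_horner0.
    rewrite /pell_P0 horner_coef0 !(coefE, coefX, coefXn, coefC) /=.
    by rewrite !mulr0 !add0r.
  - apply: (@intr_inj rat); rewrite -polyQ_horner0 HQ polyQ_scaled_horner0.
    rewrite /pell_Q0 horner_coef0 !(coefE, coefX, coefXn, coefC) /=.
    by rewrite !mulr0 !add0r.
  - apply: (@intr_inj rat); rewrite -polyQ_horner0 HD polyQ_scaled_horner0.
    rewrite /pell_D0 horner_coef0 !(coefE, coefX, coefXn, coefC) /=.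
    by rewrite !mulr0 !add0r.
have [eps [eps1 q0 /= [HP HQ HD]]] :=
  pell_family_complete pell_ab b_neq0 degP degD E Pa Qb.
set q := Q`_1 in q0 HP HQ HD.
have b0Q : b%:~R != 0 :> rat by rewrite intr_eq0.
have c0 := pell_gcd_neq0 a eps b_neq0.
have D2 : D`_2 * b ^+ 4 = ((a + eps) * q) ^+ 2.
  apply: (@intr_inj rat); move/(congr1 (fun p : {poly rat} => p`_2)): HD.
  rewrite coef_map pell_D0_scaled !(coefE, coefX, coefC, coefXn) /= => H.
  by rewrite [LHS]rmorphM /= H; field.
have D1 : D`_1 * b ^+ 3 = 2 * (a + eps) ^+ 2 * q.
  apply: (@intr_inj rat); move/(congr1 (fun p : {poly rat} => p`_1)): HD.
  rewrite coef_map pell_D0_scaled !(coefE, coefX, coefC, coefXn) /= => H.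
  by rewrite [LHS]rmorphM /= H; field.
have /dvdzP[m mE] : (b ^+ 3 %| pell_gcd a b eps * q)%Z.
  by apply: pell_gcd_clears; [rewrite -D2 | rewrite -D1]; rewrite dvdz_mull.
have tE : (pell_gcd a b eps)%:~R^-1 * m%:~R = q%:~R / b%:~R ^+ 3 :> rat.
  have c0Q : (pell_gcd a b eps)%:~R != 0 :> rat by rewrite intr_eq0.
  apply/eqP; rewrite mulrC eqr_div ?expf_neq0 // -rmorphXn -!rmorphM /= -mE.
  by rewrite mulrC.
exists m, eps; split=> //=; last by rewrite tE.
by apply: contraNneq (mulf_neq0 c0 q0) => m0; rewrite mE m0 mul0r.
Qed.
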